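(* Let $X$ be a path-inductive topological space. A real-valued function $f:X\to\mathbb{R}$ is continuous if and only if $f$ is a returning function with closed graph.
   Context: A path in a topological space $X$ is any continuous function $\gamma:[0,1]\to X$. A topological space $X$ is path-inductive if a subset $U\subset X$ is open if and only if for any path $\gamma:[0,1]\to X$ the preimage $\gamma^{-1}(U)$ is open in $[0,1]$. A function $f:X\to\mathbb{R}$ has closed graph if its graph $\Gamma_f=\{\langle x,f(x)\rangle : x\in X\}$ is a closed subset of the product $X\times\mathbb{R}$. A real-valued function $f:X\to\mathbb{R}$ on a topological space $X$ is returning at a point $x\in X$ if there exists a positive real number $M_x$ such that for every path-connected subset $C_x\subset X$ containing the point $x$ and any $y\in C_x\setminus\{x\}$ there exists a point $z\in C_x\setminus\{x,y\}$ such that $|f(z)|\le\max\{M_x,|f(y)|\}$. The function $f$ is returning if it is returning at each point $x\in X$.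
   Formalization: The space X is additionally assumed to be T1; otherwise the claim fails, e.g. a constant function on the two-point indiscrete space is continuous but not returning, and on a non-T1 space no function is returning. *)

(* Defs.v *)
From mathcomp Require Import all_boot all_order all_algebra.
From mathcomp Require Import all_classical all_reals all_analysis.
Import Order.TTheory GRing.Theory Num.Theory.
Import numFieldNormedType.Exports.

Set Implicit Arguments.
Unset Strict Implicit.
Unset Printing Implicit Defensive.

Local Open Scope classical_set_scope.
Local Open Scope ring_scope.

(* A path [0,1] -> X is represented by a map g : R -> X that is continuous on
   the subspace [0,1]; the values of g outside [0,1] play no role. *)
Definition is_path (R : realType) (X : topologicalType) (g : R -> X) : Prop :=
  {within `[0, 1], continuous g}.

(* In subspace `[0, 1] the points outside [0,1] are isolated, so a set is open
   there iff its trace on [0,1] is relatively open (open_subspaceP). *)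
Definition path_inductive (R : realType) (X : topologicalType) : Prop :=
  forall U : set X,
    open U <->
    (forall g : R -> X, is_path g ->
       open (g @^-1` U : set (subspace (`[0, 1] : set R)))).

Definition path_connected (R : realType) (X : topologicalType) (C : set X) :
    Prop :=
  forall x y, C x -> C y ->
    exists g : R -> X,
      [/\ is_path g, g @` `[0, 1] `<=` C, g 0 = x & g 1 = y].

Definition closed_graph (R : realType) (X : topologicalType) (f : X -> R) :
    Prop :=
  closed [set p : X * R | p.2 = f p.1].

(* A third point z of C is required, so f is never returning at a point of a
   two-point path-connected subset. Such subsets exist exactly when X is not
   T1: on a non-T1 space no function is returning, not even a constant one. *)
Definition returning_at (R : realType) (X : topologicalType) (f : X -> R)
    (x : X) : Prop :=
  exists M : R, 0 < M /\
    forall C : set X, path_connected R C -> C x ->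
      forall y, (C `\ x) y ->
        exists z, (C `\` [set x; y]) z /\ `|f z| <= Num.max M `|f y|.

Definition returning (R : realType) (X : topologicalType) (f : X -> R) : Prop :=
  forall x, returning_at f x.

(* Main.v *)
Require Import Defs.
From mathcomp Require Import all_boot all_order all_algebra.
From mathcomp Require Import all_classical all_reals all_analysis.
From mathcomp Require Import lra.
Import Order.TTheory GRing.Theory Num.Theory.
Import numFieldNormedType.Exports.

(** A continuous function has closed graph because the reals are Hausdorff. It
    is returning at [x] with [M = |f x| + 1]: a path from [x] to [y <> x] leaves
    [x] for the last time at some parameter [c], and just after [c] it runs
    through points other than [x] and [y] (points being closed) at which [|f|]
    is below [M] ([continuous_returning]).

    Conversely, path-inductivity reduces continuity of [f] to continuity of
    [h = f \o g] for the paths [g], which may be taken to be defined and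
    continuous on all of [R] ([path_extension]). What survives of the closed
    graph under composition with [g] is that preimages of compact sets are
    closed. For such an [h] two things have to be combined.

    - [|h|] does not tend to infinity at a point [a] from one side
      ([returning_no_left_blowup]). Otherwise, let [c] be the parameter closest
      to [a] at which [|h|] is below some large level. The image of the segment
      between [c] and [a] is path-connected, and at every point of it other than
      [g a] and [g c] the value of [|f|] exceeds both [M] and [|f (g c)|], against
      the returning property at [g a].

    - A function without one-sided blow-up is continuous
      ([no_blowup_continuous]). If [|h d| < B], then [|h|] avoids the value [B]
      on a neighbourhood of [d]. Should [|h|] exceed [B] at a point [t] of this
      neighbourhood, let [a] be the last point between [d] and [t] with
      [|h a| <= B]. Just after [a] the values of [|h|] are above [B]; as [|h a| < B],
      they avoid near [a] every compact range [[B, A]], so they tend to infinity.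
      Hence [|h|] is bounded by [B] near [d], and local boundedness is all that
      compact preimages being closed requires for continuity. *)

Set Implicit Arguments.
Unset Strict Implicit.
Unset Printing Implicit Defensive.

Local Open Scope classical_set_scope.
Local Open Scope ring_scope.

(** * Functions for which preimages of compact sets are closed *)

(** For real functions this is a form of the closed graph property, which
    unlike the graph itself passes directly to compositions. *)
Definition compact_preimages_closed (R : realType) (T : topologicalType)
    (h : T -> R) : Prop :=
  forall K : set R, compact K -> closed (h @^-1` K).

(** A tube argument: if [f x] is not in the compact set [K], the graph misses
    [{x} * K], hence a neighbourhood of it of the form [A * K]. *)
Lemma closed_graph_compact_preimages (R : realType) (X : topologicalType)
    (f : X -> R) :
  closed_graph f -> compact_preimages_closed f.
Proof.
move=> clf K /compact_near_coveringP cK.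
rewrite -[f @^-1` K]setCK; apply: open_closedC.
rewrite openE => x /= nKfx; rewrite /interior.
suff : \near x, K `<=` (fun y => y <> f x).
  by apply: filterS => x' sub Kfx'; exact: (sub _ Kfx').
apply: (cK X (nbhs x) (fun x' y => y <> f x')) => y Ky.
have : open (~` [set p : X * R | p.2 = f p.1]) by exact: closed_openC.
rewrite openE => /(_ (x, y)) nxy.
have [|[A B] [/= nA nB] AB] := nxy; first by move=> /= yfx; apply: nKfx; rewrite -yfx.
exists (B, A) => //= -[y' x'] [/= By' Ax'].
by have := AB (x', y'); apply.
Qed.

Lemma continuous_compact_preimages (R : realType) (S T : topologicalType)
    (g : S -> T) (f : T -> R) :
  continuous g -> compact_preimages_closed f -> compact_preimages_closed (f \o g).
Proof.
move=> cg hf K /hf; rewrite comp_preimage.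
exact: (continuous_closedP g).1.
Qed.

Lemma near_not_preimage (R : realType) (T : topologicalType) (h : T -> R)
    (K : set R) (t : T) :
  compact_preimages_closed h -> compact K -> ~ K (h t) ->
  \forall s \near t, ~ K (h s).
Proof.
move=> hh /hh /closed_openC + nK.
by rewrite openE => /(_ t nK).
Qed.

Lemma closed_sublevel (R : realType) (T : topologicalType) (h : T -> R) (B : R) :
  compact_preimages_closed h -> closed [set t | `|h t| <= B].
Proof.
move=> hh; rewrite (_ : [set t | _] = h @^-1` `[- B, B]).
  by apply: hh; exact: segment_compact.
by apply/seteqP; split => t /=; rewrite in_itv /= -ler_norml.
Qed.

(** Values of [|h|] near [t] cannot approach a range that [|h t|] misses: either
    they stay below [B], or they escape above any prescribed [A]. *)
Lemma near_not_annulus (R : realType) (T : topologicalType) (h : T -> R)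
    (B A : R) (t : T) :
  compact_preimages_closed h -> `|h t| < B ->
  \forall s \near t, ~ (B <= `|h s| <= A).
Proof.
move=> hh htB.
have cK : compact (`[- A, A] `&` [set y | B <= `|y|]).
  apply: compact_closedI; first exact: segment_compact.
  apply: (preimage_closed (f := fun y : R => `|y|) (D := [set y | B <= y])).
    by move=> y _; exact: norm_continuous.
  exact: closed_ge.
have nK : ~ (`[- A, A] `&` [set y | B <= `|y|]) (h t).
  by move=> [_] /=; rewrite leNgt htB.
have := near_not_preimage hh cK nK; apply: filterS => s nKs /andP[Bs sA].
by apply: nKs; split => //=; rewrite in_itv /= -ler_norml.
Qed.

(** If [h] is bounded by [B] near [t], then only the compact set of the values in
    [[-B, B]] outside a given neighbourhood of [h t] has to be avoided. *)
Lemma locally_bounded_cvg (R : realType) (T : topologicalType) (h : T -> R)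
    (B : R) (t : T) :
  compact_preimages_closed h -> (\forall s \near t, `|h s| <= B) ->
  h s @[s --> t] --> h t.
Proof.
move=> hh bh V nV.
have cK : compact (`[- B, B] `&` ~` (V°)).
  by apply: compact_closedI; [exact: segment_compact|exact/open_closedC/open_interior].
have nK : ~ (`[- B, B] `&` ~` (V°)) (h t) by move=> [_]; apply.
have := near_not_preimage hh cK nK.
rewrite nbhs_simpl /=; apply: filterS2 bh => s bs nKs.
apply: contrapT => nVs; apply: nKs; split.
  by rewrite /= in_itv /= -ler_norml.
by move=> /interior_subset.
Qed.

(** * Segments of the line and paths *)

Lemma last_point (R : realType) (S : set R) (u v : R) :
  closed S -> S u -> u <= v ->
  exists c, [/\ u <= c <= v, S c & forall t, c < t <= v -> ~ S t].
Proof.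
move=> clS Su uv.
have ne : (`[u, v] `&` S) !=set0 by exists u; split => //=; rewrite in_itv /= lexx.
have cp : compact (`[u, v] `&` S).
  by apply: compact_closedI => //; exact: segment_compact.
have ci : {within `[u, v] `&` S, continuous (@id R)}.
  by apply: continuous_subspaceT => z; exact: cvg_id.
have [c] := compact_EVT_max ne cp ci.
rewrite inE /= in_itv /= => -[ucv Sc] cmax.
exists c; split => // t /andP[ct tv] St.
have := cmax t; rewrite inE /= in_itv /= tv (le_trans (andP ucv).1 (ltW ct)).
by move=> /(_ (conj isT St)); rewrite leNgt ct.
Qed.

Lemma at_left_itv (R : realType) (a : R) (P : set R) :
  (\forall t \near a^'-, P t) -> exists2 b, b < a & forall t, b < t < a -> P t.
Proof.
rewrite near_withinE => /nbhs_ballP[e /= e0 ab].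
exists (a - e); first by rewrite ltrBlDr ltrDl.
move=> t /andP[bt ta]; apply: ab => //=.
by rewrite /ball /= gtr0_norm ?subr_gt0 // ltrBlDr addrC -ltrBlDr.
Qed.

Lemma segment_image_path_connected (R : realType) (X : topologicalType)
    (g : R -> X) (u v : R) :
  continuous g -> path_connected R (g @` `[u, v]).
Proof.
move=> cg x y [s /= + <-] [t /= + <-]; rewrite !in_itv /= => suv tuv.
exists (g \o line_path s t); split.
- apply: continuous_subspaceT => z; apply: continuous_comp; last exact: cg.
  apply: cvgD; last by apply: cvgMr_tmp; exact: cvg_id.
  by apply: cvgMr_tmp; apply: cvgB; [exact: cvg_cst|exact: cvg_id].
- move=> _ [r /= + <-]; rewrite in_itv /= => r01.
  by exists (line_path s t r) => //=; rewrite in_itv /= /line_path; nra.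
- by rewrite /= line_path0.
- by rewrite /= line_path1.
Qed.

(** Precomposing with the retraction of the line onto [[0, 1]] removes the
    boundary of the parameter interval, where only one-sided limits exist. *)
Lemma path_extension (R : realType) (X : topologicalType) (g : R -> X) :
  is_path g ->
  exists G : R -> X, [/\ continuous G, {in `[0, 1]%classic, G =1 g} &
    forall t, (g @` `[0, 1]) (G t)].
Proof.
move=> /subspace_continuousP pg.
pose clamp (t : R) := Num.max 0 (Num.min t 1).
have clamp01 t : `[0, 1]%classic (clamp t).
  by rewrite /= in_itv /= /clamp le_max lexx /= ge_max ler01 ge_min lexx orbT.
exists (g \o clamp); split.
- move=> t A nA.
  have cc : continuous (cst 0 \max (id \min cst 1) : R -> R).
    apply: max_fun_continuous => [?|]; first exact: cvg_cst.
    by apply: min_fun_continuous => ?; [exact: cvg_id|exact: cvg_cst].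
  have /(cc t) := pg _ (clamp01 t) A nA.
  by rewrite !nbhs_simpl /=; apply: filterS => s; apply; exact: clamp01.
- move=> t; rewrite inE /= in_itv /= => /andP[t0 t1].
  by rewrite /clamp min_l // max_r.
- by move=> t; exists (clamp t).
Qed.

(** * From returning to continuous *)

(** The returning property is applied at [g a] to the image of a segment [[c, a]]
    chosen so that its two end points are exactly those of smallest [|f|]. *)
Lemma returning_no_left_blowup (R : realType) (X : topologicalType) (f : X -> R)
    (g : R -> X) (a : R) :
  returning f -> compact_preimages_closed f -> continuous g ->
  ~ (`|f (g t)| @[t --> a^'-] --> +oo).
Proof.
move=> rf hf cg /cvgryPgt blow.
have hh := continuous_compact_preimages cg hf.
have [M [M0 rM]] := rf (g a).
have [b ba hb] := at_left_itv (blow (Num.max M `|f (g a)|)).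
(* The level |f (g t0)| exceeds M and |f (g a)|; on [t0, v] the point c is the
   last one not above this level, and beyond v there is none before a. *)
pose t0 := (b + a) / 2; have [bt0 t0a] : b < t0 /\ t0 < a by rewrite /t0; lra.
have [b' b'a hb'] := at_left_itv (blow `|f (g t0)|).
pose v := Num.max t0 ((b' + a) / 2).
have [b'v va t0v] : [/\ b' < v, v < a & t0 <= v].
  by rewrite /v !lt_max !gt_max !le_max lexx; split=> //; lra.
have [c [/andP[t0c cv] /= hc cmax]] :=
  last_point (@closed_sublevel _ _ _ `|f (g t0)| hh) (lexx _) t0v.
have ca : c < a := le_lt_trans cv va.
have hct t : c < t -> t < a -> `|f (g t0)| < `|f (g t)|.
  move=> ct ta; have [tv|vt] := leP t v.
    by rewrite ltNge; apply/negP; apply: cmax; rewrite ct.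
  by apply: hb'; rewrite ta andbT (lt_trans b'v).
have /(_ c) := hb; rewrite ca (lt_le_trans bt0 t0c) gt_max => /(_ isT) /andP[Mc ac].
have [] := rM (g @` `[c, a]) (@segment_image_path_connected _ _ _ c a cg) _ (g c).
- by exists a => //=; rewrite in_itv /= lexx ltW.
- split; first by exists c => //=; rewrite in_itv /= lexx ltW.
  by move=> /= ga; rewrite ga ltxx in ac.
move=> z [[[t /= + <-] ne]]; rewrite in_itv /= => /andP[ct ta].
have gt : `|f (g t0)| < `|f (g t)|.
  apply: hct; rewrite lt_neqAle.
    by rewrite ct andbT; apply/eqP => tc; apply: ne; right; rewrite -tc.
  by rewrite ta andbT; apply/eqP => tc; apply: ne; left; rewrite -tc.
have gc_gt := le_lt_trans hc gt.
by rewrite le_max leNgt (lt_trans Mc gc_gt) leNgt gc_gt.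
Qed.

(** The last point [a] before [t] with [|h a| <= B] is a point of right blow-up,
    because [|h|] is above [B] after [a] and jumps there over every range
    [[B, A]]. *)
Lemma no_right_crossing (R : realType) (h : R -> R) (B d t : R) :
  compact_preimages_closed h ->
  (forall a, ~ (`|h s| @[s --> a^'+] --> +oo)) ->
  d <= t -> `|h d| < B -> (forall s, d <= s <= t -> `|h s| != B) ->
  `|h t| < B.
Proof.
move=> hh nblow dt hd hB; rewrite ltNge; apply/negP => Bt.
have [a [/andP[da at_] ha amax]] := last_point (@closed_sublevel _ _ _ B hh) (ltW hd) dt.
have haB : `|h a| < B by rewrite lt_neqAle ha hB ?da.
have lt_at : a < t.
  by rewrite lt_neqAle at_ andbT; apply: contraTneq Bt => <-; rewrite -ltNge.
apply: (nblow a); apply/cvgryPgt => A.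
rewrite near_withinE.
have nt : \forall s \near a, s < t by exact: lt_nbhsl.
have := @near_not_annulus _ _ _ B A a hh haB.
apply: filterS2 nt => s st nKs as_.
rewrite ltNge; apply/negP => sA; apply: nKs; rewrite sA andbT.
rewrite leNgt; apply/negP => /ltW sB.
by apply: (amax s); rewrite ?as_ ?ltW.
Qed.

Lemma no_blowup_continuous (R : realType) (h : R -> R) :
  compact_preimages_closed h ->
  (forall a, ~ (`|h s| @[s --> a^'+] --> +oo)) ->
  (forall a, ~ (`|h s| @[s --> a^'-] --> +oo)) ->
  continuous h.
Proof.
move=> hh nr nl d; pose B := `|h d| + 1.
have hdB : `|h d| < B by rewrite ltrDl.
apply: (@locally_bounded_cvg _ _ _ B) => //.
have /nbhs_ballP[e /= e0 de] := @near_not_annulus _ _ _ B B d hh hdB.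
have hB s : `|d - s| < e -> `|h s| != B.
  by move=> /de nKs; apply/eqP => hsB; apply: nKs; rewrite hsB lexx.
apply/nbhs_ballP; exists e => // t; rewrite /ball /= => dt.
apply: ltW; have [dlt|tld] := leP d t.
  apply: (@no_right_crossing _ h B d t) => // s /andP[ds st].
  by apply: hB; move: dt; rewrite !ltr_norml; lra.
(* To the left of d, the reflection of h is crossed from the right. *)
rewrite -[t]opprK; apply: (@no_right_crossing _ (h \o -%R) B (- d) (- t)).
- by apply: continuous_compact_preimages => //; exact: oppr_continuous.
- by move=> a; have := nl (- a); rewrite at_leftN.
- by rewrite lerN2 ltW.
- by rewrite /= opprK.
- by move=> s dst; apply: hB; move: dt; rewrite !ltr_norml; lra.
Qed.

Lemma returning_closed_graph_continuous (R : realType) (X : topologicalType)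
    (f : X -> R) :
  path_inductive R X -> returning f -> closed_graph f -> continuous f.
Proof.
move=> Xpi rf /closed_graph_compact_preimages hf.
apply/continuousP => V oV; apply/Xpi => g /path_extension[G [cG Gg _]].
have cfG : continuous (f \o G).
  apply: no_blowup_continuous; first exact: continuous_compact_preimages.
  - move=> a; have := @returning_no_left_blowup _ _ f (G \o -%R) (- a) rf hf.
    move=> H K; apply: H.
      by move=> t; apply: continuous_comp; [exact: oppr_continuous|exact: cG].
    by move: K; rewrite -[a in a^'+]opprK at_rightN.
  - by move=> a; exact: (returning_no_left_blowup rf hf cG).
have cfg : {within `[0, 1], continuous (f \o g)}.
  apply: (@subspace_eq_continuous _ _ _ (f \o G)); last exact: continuous_subspaceT.
  by move=> t t01 /=; rewrite Gg.
rewrite -comp_preimage.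
exact: ((continuousP _).1 cfg).
Qed.

(** * From continuous to returning *)

Lemma continuous_closed_graph (R : realType) (X : topologicalType) (f : X -> R) :
  continuous f -> closed_graph f.
Proof.
move=> cf; rewrite /closed_graph.
rewrite (_ : [set p | _] = (fun p : X * R => p.2 - f p.1) @^-1` [set 0]).
  apply: preimage_closed; last exact: closed_eq.
  move=> p _; apply: cvgB; first exact: cvg_snd.
  by apply: continuous_comp; [exact: cvg_fst|exact: cf].
apply/seteqP; split => p /= => [->|/eqP]; first by rewrite subrr.
by rewrite subr_eq0 => /eqP.
Qed.

(** Points are closed, so the path stays away from [y] just after its last visit
    [c] to [x], and it has to be followed only slightly beyond [c]. *)
Lemma continuous_returning (R : realType) (X : topologicalType) (f : X -> R) :
  accessible_space X -> continuous f -> returning f.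
Proof.
move=> XT1 cf x; exists (`|f x| + 1); split; first by rewrite ltr_wpDl.
move=> C Cpc Cx y [Cy /= yx].
have [g [/path_extension[G [cG Gg GC]] gC g0 g1]] := Cpc x y Cx Cy.
have G0 : G 0 = x by rewrite Gg // inE /= in_itv /= lexx ler01.
have G1 : G 1 = y by rewrite Gg // inE /= in_itv /= lexx ler01.
have cl1 z : closed (G @^-1` [set z]).
  by apply: preimage_closed => [t _|]; [exact: cG|exact: accessible_closed_set1].
have [c [/andP[c0 c1] /= Gc cmax]] := last_point (cl1 x) G0 ler01.
have c1' : c < 1.
  by rewrite lt_neqAle c1 andbT; apply/eqP => E; apply: yx; rewrite -G1 -E.
have ny : \forall t \near c^'+, G t <> y.
  apply: cvg_within; rewrite nbhs_simpl /=.
  have /closed_openC := cl1 y; rewrite openE => /(_ c) /=; apply.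
  by rewrite Gc => xy; apply: yx.
have nf : \forall t \near c^'+, `|f (G t)| < `|f x| + 1.
  apply: cvg_within; rewrite nbhs_simpl /=.
  have cn : `|f (G t)| @[t --> c] --> `|f x|.
    by rewrite -Gc; apply: cvg_norm; apply: continuous_comp; [exact: cG|exact: cf].
  by apply: (cvgr_lt _ cn); rewrite ltrDl.
near c^'+ => t.
exists (G t); split; last first.
  by rewrite le_max ltW //; near: t.
split; first exact: gC.
move=> /= -[Gtx|]; last by near: t.
by apply: (cmax t) => //; apply/andP; split; near: t;
  [exact: nbhs_right_gt|exact: nbhs_right_le].
Unshelve. all: by end_near. Qed.

(** * The equivalence *)

Theorem theorem2 (R : realType) (X : topologicalType) (XT1 : accessible_space X)
    (Xpi : path_inductive R X) (f : X -> R) :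
  continuous f <-> returning f /\ closed_graph f.
Proof.
split=> [cf|[rf clf]].
  by split; [exact: continuous_returning|exact: continuous_closed_graph].
exact: returning_closed_graph_continuous.
Qed.
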